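(* Let $f:[0,1]\to\mathbb{R}$ be an absolutely continuous function such that $f'\in L_1(0,1)$ and there exist real numbers $\gamma_1,\Gamma_1$ such that $\gamma_1\le f'(t)\le\Gamma_1$ for $t\in[0,1]$. Let $S=f(1)-f(0)$. Then $$|Q(f;0,1)|\le\frac{\Gamma_1-\gamma_1}{32}(5-2\sqrt2),$$ $$|Q(f;0,1)|\le\left(\frac12-\frac{\sqrt2}{8}\right)(S-\gamma_1),$$ $$|Q(f;0,1)|\le\left(\frac12-\frac{\sqrt2}{8}\right)(\Gamma_1-S).$$
   Context: For $f$ on $[0,1]$, $$Q(f;0,1)=\int_0^1 f(t)\,dt-\left[\frac{\sqrt2}{8}f(0)+\left(1-\frac{\sqrt2}{4}\right)f\left(\tfrac12\right)+\frac{\sqrt2}{8}f(1)\right].$$ The derivative $f'$ of the absolutely continuous function $f$ exists almost everywhere, and the bounds $\gamma_1\le f'(t)\le\Gamma_1$ are understood for almost every $t$. *)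

(* Defs.v *)
From mathcomp Require Export all_boot all_order all_algebra.
From mathcomp Require Export all_classical all_reals all_analysis.
Export numFieldNormedType.Exports.

Set Implicit Arguments.
Unset Strict Implicit.
Unset Printing Implicit Defensive.

Import Order.TTheory GRing.Theory Num.Theory.
Local Open Scope classical_set_scope.
Local Open Scope ring_scope.

(* A function [a, b] -> R is represented by a total f : R -> R whose values
   outside [a, b] are irrelevant. *)
Definition absolutely_continuous_on (R : realType) (a b : R) (f : R -> R) :
    Prop :=
  forall e : R, 0 < e -> exists2 d : R, 0 < d &
    forall (n : nat) (u v : 'I_n -> R),
      (forall i, [/\ a <= u i, u i < v i & v i <= b]) ->
      trivIset [set: 'I_n] (fun i => `]u i, v i[%classic) ->
      \sum_(i < n) (v i - u i) < d ->
      \sum_(i < n) `|f (v i) - f (u i)| < e.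

Definition Q01 (R : realType) (f : R -> R) : R :=
  (\int[lebesgue_measure]_(t in `[0, 1]) f t)
  - (Num.sqrt 2 / 8 * f 0 + (1 - Num.sqrt 2 / 4) * f (1 / 2)
     + Num.sqrt 2 / 8 * f 1).

(* Main.v *)
Require Import Defs.
From HB Require Import structures.
From mathcomp Require Import measurable_realfun ring lra.

(** Only the slopes of f matter: once
      gamma1 * (y - x) <= f y - f x <= Gamma1 * (y - x)   (0 <= x <= y <= 1),
    elementary comparisons give the three estimates.  Indeed a slope bound
    squeezes f, on any interval, between two affine functions through either
    endpoint, hence squeezes its integral (Rintegral_slopes).  Write
    w = sqrt 2 / 8 for the weight of the endpoints.  Cutting [0, 1] at w, 1/2
    and 1 - w makes each node the endpoint of pieces whose total length is its
    weight, and the errors add up to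
    (Gamma1 - gamma1) / 2 * (w ^ 2 + (1/2 - w) ^ 2), which is the first bound
    since w ^ 2 = 1/32 (symmetric_rule_range).  Cutting at 1/2 only, and
    comparing with affine functions of slope gamma1 (resp. Gamma1), gives the
    bounds in terms of the increment S (symmetric_rule_increment); there
    w <= 1/4 makes the weight of the middle node at least 1/2.

    The hard part is to pass from the derivative, known almost everywhere and
    only where it exists, to the slopes.  This is Lebesgue's theorem that an
    absolutely continuous f is the integral of some integrable h
    (absolutely_continuous_density).  The total variation V of f is again
    absolutely continuous, and f = V - (V - f) is a difference of nondecreasing
    absolutely continuous functions.  For such a function g, the
    Lebesgue-Stieltjes measure of g vanishes on Lebesgue null sets: a null set
    lies in an open set of small measure, which is a disjoint union of open
    intervals, and absolute continuity bounds the sum of the increments of g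
    over them.  The Radon-Nikodym theorem provides the density.  By the Lebesgue
    differentiation theorem f' exists and equals h almost everywhere, so that
    gamma1 <= h <= Gamma1 almost everywhere, and integrating h gives the slopes
    (absolutely_continuous_slopes). *)

Set Implicit Arguments.
Unset Strict Implicit.
Unset Printing Implicit Defensive.

Import Order.TTheory GRing.Theory Num.Theory.
Local Open Scope classical_set_scope.
Local Open Scope ring_scope.

(** * Absolutely continuous functions and their total variation *)

Section absolute_continuity.
Context {R : realType}.
Implicit Types (a b : R) (f g : R -> R).

(** The pieces of several partitions are naturally indexed by a sigma type, and
    truncating intervals can make them degenerate; degenerate intervals contribute
    nothing to either sum. *)
Lemma absolutely_continuous_finType a b f :
  absolutely_continuous_on a b f -> forall e : R, 0 < e -> exists2 d : R, 0 < d &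
    forall (I : finType) (u v : I -> R),
      (forall i, [/\ a <= u i, u i <= v i & v i <= b]) ->
      trivIset [set: I] (fun i => `]u i, v i[%classic) ->
      \sum_i (v i - u i) < d -> \sum_i `|f (v i) - f (u i)| < e.
Proof.
move=> fac e /fac[d d0 fd]; exists d => // I u v uv tuv sd.
pose P := [pred i | u i < v i].
have deg i : ~~ P i -> v i = u i.
  by rewrite /= -leNgt => vu; have [_ uvi _] := uv i; apply/le_anti/andP.
have sumP (F : R -> R) :
    \sum_i `|F (v i) - F (u i)| = \sum_(i in P) `|F (v i) - F (u i)|.
  rewrite (bigID P)/= [X in _ + X]big1 ?addr0// => i /deg ->.
  by rewrite subrr normr0.
rewrite sumP big_enum_val; apply: fd => [i|i j _ _ ij|].
- by have [? ? ?] := uv (enum_val i); split => //; exact: (enum_valP i).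
- by apply: enum_val_inj; exact: tuv.
- have normE i : v i - u i = `|v i - u i|.
    by rewrite ger0_norm// subr_ge0; have [] := uv i.
  apply: le_lt_trans sd; rewrite -(big_enum_val (fun i => v i - u i)).
  by under eq_bigr do rewrite normE; under [leRHS]eq_bigr do rewrite normE;
    rewrite (sumP id).
Qed.

Lemma absolutely_continuousB a b f g : absolutely_continuous_on a b f ->
  absolutely_continuous_on a b g -> absolutely_continuous_on a b (f \- g).
Proof.
move=> fac gac e e0; have e20 : 0 < e / 2 by rewrite divr_gt0.
have [d d0 fd] := fac _ e20; have [d' d'0 gd] := gac _ e20.
exists (Num.min d d') => [|n u v uv tuv]; first by rewrite lt_min d0.
rewrite lt_min => /andP[sd sd']; rewrite (splitr e).
apply: le_lt_trans (ltrD (fd _ _ _ uv tuv sd) (gd _ _ _ uv tuv sd')).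
rewrite -big_split/=; apply: ler_sum => i _.
rewrite -(normrN (g _ - _)); apply: le_trans (ler_normD _ _).
by rewrite le_eqVlt; apply/orP/or_introl/eqP; congr `|_|; ring.
Qed.

(** Turns a partition into a disjoint family of intervals, the form in which
    absolute continuity can be applied to a variation. *)
Lemma itv_partition_knots a b s : itv_partition a b s ->
  let u i := nth b (a :: s) i in
  [/\ forall i, (i < size s)%N -> [/\ a <= u i, u i < u i.+1 & u i.+1 <= b],
      {in [pred i | (i < size s)%N] &, forall i j x, x \in `]u i, u i.+1[ ->
         x \in `]u j, u j.+1[ -> i = j} &
      \sum_(i < size s) (u i.+1 - u i) = b - a].
Proof.
move=> ps; have [sa /eqP sb] := ps; move=> u.
have ltu : {in [pred i | (i <= size s)%N] &, {homo u : i j / (i < j)%N >-> i < j}}.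
  move=> i j; rewrite !inE => si sj ij.
  by rewrite (@lt_sorted_ltn_nth _ _ b (a :: s)) ?inE.
have leu i j : (i <= j <= size s)%N -> u i <= u j.
  move=> /andP[]; rewrite leq_eqVlt => /predU1P[->//|ij js].
  by apply/ltW/ltu => //; rewrite inE// (leq_trans (ltnW ij)).
have u0 : u 0%N = a by [].
have us : u (size s) = b by rewrite /u -sb -last_nth (last_nth b).
split=> [i si|i j si sj x|].
- split; [by rewrite -u0 leu//= ltnW| by rewrite ltu// inE// ltnW|].
  by rewrite -us leu// si /=.
- rewrite !in_itv/= => /andP[ix xi] /andP[jx xj].
  have key k l : (k < l)%N -> (l < size s)%N -> x < u k.+1 -> u l < x -> False.
    move=> kl ls xk lx; have := lt_trans lx xk.
    by rewrite ltNge leu// kl ltnW.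
  case: (ltngtP i j) => // ij.
  + by case: (key i j).
  + by case: (key j i).
- by rewrite -(big_mkord xpredT (fun i => u i.+1 - u i)) telescope_sumr// us u0.
Qed.

Lemma total_variation_fin_num a b f : a <= b -> bounded_variation a b f ->
  total_variation a b f \is a fin_num.
Proof. by move=> ab /bounded_variationP; exact. Qed.

(** With the modulus d attached to e = 1, the variation over an interval shorter
    than d is at most 1, and finitely many intervals of length d / 2 cover
    [a, b]. *)
Lemma absolutely_continuous_bounded_variation a b f : a <= b ->
  absolutely_continuous_on a b f -> bounded_variation a b f.
Proof.
move=> ab fac; have [d d0 fd] := absolutely_continuous_finType fac ltr01.
have short x y : a <= x -> x <= y -> y <= b -> y - x < d ->
    bounded_variation x y f.
  move=> ax xy yb xyd; exists 1 => _ [s ps <-].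
  have [/= h1 h2 h3] := itv_partition_knots ps.
  rewrite /variation/= big_mkord ltW//.
  apply: (fd _ (fun i : 'I__ => nth y (x :: s) i)
               (fun i : 'I__ => nth y (x :: s) i.+1)).
  + move=> i; have [xu uv vy] := h1 _ (ltn_ord i).
    by split; [exact: le_trans xu|exact: ltW|exact: le_trans yb].
  + move=> i j _ _ [z [zi zj]]; apply/val_inj.
    by apply: (h2 _ _ (ltn_ord i) (ltn_ord j) z).
  + by rewrite h3.
suff step n : forall y, a <= y -> y <= b -> y - a <= n%:R * (d / 2) ->
    bounded_variation a y f.
  have [n nP] : exists n : nat, (b - a) / (d / 2) <= n%:R.
    exists (Num.bound ((b - a) / (d / 2))); apply/ltW/archi_boundP.
    by rewrite divr_ge0// ?subr_ge0// ltW// divr_gt0.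
  by apply: (step n) => //; rewrite -ler_pdivrMr// divr_gt0.
elim: n => [y ay yb|n ih y ay yb yn].
  rewrite mul0r subr_le0 => ya; have -> : y = a by apply/le_anti/andP.
  exact: bounded_variationxx.
have [yd|dy] := ltP (y - a) d; first exact: short.
have d20 : 0 < d / 2 by rewrite divr_gt0.
have az : a <= y - d / 2 by lra.
have zy : y - d / 2 <= y by lra.
have zb : y - d / 2 <= b by exact: le_trans yb.
apply/bounded_variationP => //; rewrite (total_variationD f az zy) fin_numD.
rewrite !total_variation_fin_num//; first by apply: short => //; lra.
apply: ih => //; move: yn; rewrite -natr1 mulrDl mul1r; lra.
Qed.

(** On each interval of a disjoint family, a partition nearly attains the total
    variation of f.  All the pieces of these partitions together form a disjoint
    family of the same total length, to which the modulus of f applies. *)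
Lemma absolutely_continuous_total_variation a b f : a <= b ->
  absolutely_continuous_on a b f ->
  absolutely_continuous_on a b (fun x => fine (total_variation a x f)).
Proof.
move=> ab fac e e0; have e20 : 0 < e / 2 by rewrite divr_gt0.
have bvf := absolutely_continuous_bounded_variation ab fac.
have [d d0 fd] := absolutely_continuous_finType fac e20.
exists d => // n u v uv tuv sd.
(* n partitions, each with an error eta, cost less than e / 2 in total *)
pose eta := e / 2 / n.+1%:R.
have eta0 : 0 < eta by rewrite divr_gt0.
have /choice[s sP] (i : 'I_n) : exists s, itv_partition (u i) (v i) s /\
    `|fine (total_variation a (v i) f) - fine (total_variation a (u i) f)| <=
    variation (u i) (v i) f s + eta.
  have [au ltuv vb] := uv i; have leuv := ltW ltuv.
  have bvu : bounded_variation a (u i) f.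
    by apply: (bounded_variationl au _ bvf); exact: le_trans vb.
  have bvuv : bounded_variation (u i) (v i) f.
    apply: (bounded_variationl leuv vb).
    by apply: (bounded_variationr au _ bvf); exact: le_trans vb.
  have finuv := total_variation_fin_num leuv bvuv.
  rewrite (total_variationD f au leuv) fineD// ?total_variation_fin_num//.
  rewrite addrAC subrr add0r ger0_norm ?fine_ge0 ?total_variation_ge0//.
  have : (total_variation (u i) (v i) f - eta%:E < total_variation (u i) (v i) f)%E.
    by rewrite lteBlDr// lteDl// lte_fin.
  rewrite {2}/total_variation => /ereal_sup_gt[_ [_ [s ps <-] <-]] h.
  exists s; split => //; rewrite -lerBlDr ltW// -lte_fin EFinB fineK//.
have pK i := itv_partition_knots (sP i).1.
pose J := {i : 'I_n & 'I_(size (s i))}.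
pose U (j : J) := nth (v (tag j)) (u (tag j) :: s (tag j)) (tagged j).
pose V (j : J) := nth (v (tag j)) (u (tag j) :: s (tag j)) (tagged j).+1.
have UV j : [/\ u (tag j) <= U j, U j < V j & V j <= v (tag j)].
  by have [h1 _ _] := pK (tag j); exact: (h1 _ (ltn_ord (tagged j))).
have sumJ (F : forall i, 'I_(size (s i)) -> R) :
    \sum_(j : J) F (tag j) (tagged j) = \sum_i \sum_(k < size (s i)) F i k.
  by rewrite sig_big_dep.
have fUV : \sum_j `|f (V j) - f (U j)| < e / 2.
  apply: fd.
  - move=> j; have [uU UVj Vv] := UV j; have [au _ vb] := uv (tag j).
    by split; [exact: le_trans uU|exact: ltW|exact: le_trans vb].
  - move=> j j' _ _ [z [/= zj zj']].
    have tagE : tag j = tag j'.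
      apply: tuv => //; exists z; split => /=.
      + have [uU _ Vv] := UV j; move: zj; rewrite !in_itv/= => /andP[h1 h2].
        by rewrite (le_lt_trans uU)//= (lt_le_trans h2).
      + have [uU _ Vv] := UV j'; move: zj'; rewrite !in_itv/= => /andP[h1 h2].
        by rewrite (le_lt_trans uU)//= (lt_le_trans h2).
    case: j j' tagE zj zj' => [i k] [i' k'] /= ii'.
    case: _ / ii' k' => k' zj zj'; congr existT; apply: val_inj.
    by have [_ h2 _] := pK i; apply: (h2 _ _ (ltn_ord k) (ltn_ord k') z).
  - rewrite (sumJ (fun i k => nth (v i) (u i :: s i) k.+1
                              - nth (v i) (u i :: s i) k)).
    by under eq_bigr => i _ do (have [_ _ ->] := pK i).
rewrite (splitr e); apply: (@le_lt_trans _ _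
    (\sum_j `|f (V j) - f (U j)| + \sum_(i < n) eta)).
  rewrite (sumJ (fun i k => `|f (nth (v i) (u i :: s i) k.+1)
                              - f (nth (v i) (u i :: s i) k)|)).
  rewrite -big_split; apply: ler_sum => i _.
  by have [_] := sP i; rewrite /variation/= big_mkord.
apply: ltr_leD => //; rewrite sumr_const card_ord -[leLHS]mulr_natr /eta mulrAC.
by rewrite ler_pdivrMr// ler_pM2l// ler_nat.
Qed.

End absolute_continuity.

(** * Extension of a function by constants *)

Section clamp.
Context {R : realType} (a b : R).
Hypothesis ab : a < b.

Definition clamp (x : R) := Num.max a (Num.min b x).

Lemma clamp_itv x : a <= clamp x <= b.
Proof.
by rewrite /clamp le_max lexx/= ge_max (ltW ab) ge_min lexx.
Qed.

Lemma clampE x : a <= x <= b -> clamp x = x.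
Proof. by move=> /andP[ax xb]; rewrite /clamp min_r// max_r. Qed.

Lemma clamp_le x y : x <= y -> clamp x <= clamp y.
Proof. by move=> xy; rewrite /clamp le_max2// le_min2. Qed.

Lemma clampB x y : x <= y -> clamp y - clamp x <= y - x.
Proof.
move=> xy; rewrite /clamp /Num.max /Num.min.
by do ![case: ifPn => //=]; rewrite -?leNgt; lra.
Qed.

Lemma clamp_oo x y : `]clamp x, clamp y[ `<=` `]x, y[.
Proof.
move=> z /=; rewrite !in_itv/= /clamp gt_max lt_max gt_min lt_min.
move=> /andP[/andP[az xz]] /orP[za|/andP[zb zy]].
  by have := lt_trans az za; rewrite ltxx.
by move: xz; rewrite zy andbT => /orP[bz|//]; have := lt_trans bz zb; rewrite ltxx.
Qed.

End clamp.

(** Extending an absolutely continuous function by constants on both sides keeps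
    the modulus: truncation shortens intervals and keeps them disjoint. *)
Lemma absolutely_continuous_clamp (R : realType) (a b : R) (g : R -> R) (e : R) :
  a < b -> absolutely_continuous_on a b g -> 0 < e -> exists2 d : R, 0 < d &
  forall (I : finType) (u v : I -> R), (forall i, u i <= v i) ->
    trivIset [set: I] (fun i => `]u i, v i[%classic) ->
    \sum_i (v i - u i) < d ->
    \sum_i `|g (clamp a b (v i)) - g (clamp a b (u i))| < e.
Proof.
move=> ab g_ac /(absolutely_continuous_finType g_ac)[d d0 gd].
exists d => // I u v uv tuv sd; apply: gd.
- move=> i; have /andP[h1 h2] := clamp_itv ab (u i).
  by have /andP[h3 h4] := clamp_itv ab (v i); split=> //; exact: clamp_le.
- move=> i j _ _ [z [zi zj]]; apply: tuv => //.
  by exists z; split; [exact: (clamp_oo zi)|exact: (clamp_oo zj)].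
- apply: le_lt_trans sd; apply: ler_sum => i _; exact: clampB.
Qed.

Lemma absolutely_continuous_clamp_continuous (R : realType) (a b : R) (g : R -> R) :
  a < b -> absolutely_continuous_on a b g -> continuous (g \o clamp a b).
Proof.
move=> ab g_ac x; apply/(@cvgrPdist_lt _ R^o) => e.
move=> /(absolutely_continuous_clamp ab g_ac)[d d0 gd].
near=> y.
have key (s t : R) : s <= t -> t - s < d ->
    `|g (clamp a b t) - g (clamp a b s)| < e.
  move=> st std; have := gd unit (fun=> s) (fun=> t) (fun=> st).
  rewrite !big_const card_unit /= !addr0; apply => //.
  by move=> [] [].
have xyd : `|x - y| < d by near: y; exact: (@cvgr_dist_lt _ R^o).
have [xy|/ltW yx] := leP x y.
- by rewrite distrC; apply: key => //; rewrite distrC ger0_norm ?subr_ge0 in xyd.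
- by apply: key => //; rewrite ger0_norm ?subr_ge0 in xyd.
Unshelve. all: by end_near. Qed.

Lemma absolutely_continuous_integrable (R : realType) (a b : R) (f : R -> R) :
  a < b -> absolutely_continuous_on a b f ->
  (@lebesgue_measure R).-integrable `[a, b] (EFin \o f).
Proof.
move=> ab fac.
have : lebesgue_measure.-integrable `[a, b] (EFin \o (f \o clamp a b)).
  apply: continuous_compact_integrable; first exact: segment_compact.
  exact/continuous_subspaceT/absolutely_continuous_clamp_continuous.
apply: eq_integrable => // x; rewrite inE/= in_itv/= => xab.
by rewrite clampE.
Qed.

(** * Densities of absolutely continuous functions *)

Lemma lebesgue_stieltjes_measure_oc (R : realType) (G : cumulative R R) (x y : R) :
  x <= y -> lebesgue_stieltjes_measure G `]x, y]%classic = (G y - G x)%:E.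
Proof.
move=> xy; rewrite /lebesgue_stieltjes_measure /measure_extension/=.
rewrite measurable_mu_extE/=; last exact: is_ocitv.
by rewrite wlength_itv_bnd.
Qed.

Lemma open_bounded_interval_oo (R : realType) (A : set R) : open A -> is_interval A ->
  has_ubound A -> has_lbound A -> exists u v : R, u <= v /\ A = `]u, v[%classic.
Proof.
move=> oA iA ubA lbA; have [->|/set0P[x Ax]] := eqVneq A set0.
  by exists 0, 0; rewrite set_itv_ge// bnd_simp ltxx.
exists (inf A), (sup A); split.
  by apply: (@le_trans _ _ x); [exact: ge_inf|exact: ub_le_sup].
by apply/esym; rewrite -interval_bounded_interior//; move: oA; rewrite interior_id.
Qed.

Section monotone_density.
Context {R : realType} (a b : R) (g : R -> R).
Hypotheses (ab : a < b) (g_ac : absolutely_continuous_on a b g)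
  (g_nd : {in `[a, b] &, nondecreasing_fun g}).

Let G := g \o clamp a b.

Let G_nd : nondecreasing_fun G.
Proof.
by move=> x y xy; apply: g_nd; rewrite ?in_itv ?clamp_itv ?clamp_le.
Qed.

#[local] HB.instance Definition _ := isCumulative.Build R _ R G
  G_nd (right_continuousW (absolutely_continuous_clamp_continuous ab g_ac)).

Notation mu := (@lebesgue_measure R).
Let nu : {measure set (measurableTypeR R) -> \bar R} :=
  lebesgue_stieltjes_measure G.

(** An open cover of N of Lebesgue measure less than d splits into disjoint open
    intervals, whose finite subfamilies are ruled by the modulus of g. *)
Let nu_dominated (N : set R) : measurable N -> N `<=` `]a, b] -> mu N = 0%E ->
  nu N = 0%E.
Proof.
move=> mN Nab N0; apply/eqP; rewrite eq_le measure_ge0 andbT.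
apply/lee_addgt0Pr => e e0; rewrite add0e.
have [d d0 Gd] := absolutely_continuous_clamp ab g_ac e0.
have muN : (mu N < +oo)%E by rewrite N0 ltry.
have [V [oV NV muVN]] := lebesgue_regularity_outer mN muN d0.
(* bounded, so that its components have endpoints *)
pose W := V `&` `]a - 1, b + 1[.
have oW : open W by apply: openI => //; exact: interval_open.
have mW : measurable W by exact: open_measurable.
have NW : N `<=` W.
  move=> x Nx; split; first exact: NV.
  by have := Nab _ Nx; rewrite /= !in_itv/= => /andP[ax xb]; apply/andP; split; lra.
have muW : (mu W < d%:E)%E.
  apply: le_lt_trans muVN; rewrite -[leRHS]add0e -[X in (X + _)%E]N0.
  apply: le_trans (measureU2 _ _ _) => //; last first.
    by apply: measurableD => //; exact: open_measurable.
  rewrite setDUK//; apply: le_measure; rewrite ?inE//; first exact: open_measurable.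
  exact: subIsetl.
pose I := open_disjoint_itv oW.
have mI k : measurable (I k).
  by apply: open_measurable; exact: open_disjoint_itv_open.
have tI : trivIset setT I by exact: open_disjoint_itv_trivIset.
have WI : W = \bigcup_k I k by exact: open_disjoint_itv_bigcup.
have /choice[uv uvP] k : exists p : R * R, p.1 <= p.2 /\ I k = `]p.1, p.2[%classic.
  have IW : I k `<=` `]a - 1, b + 1[.
    apply: (@subset_trans _ W); last exact: subIsetr.
    by rewrite WI; exact: bigcup_sup.
  have [||||x [y xy]] := @open_bounded_interval_oo _ (I k).
  - exact: open_disjoint_itv_open.
  - exact: open_disjoint_itv_is_interval.
  - by exists (b + 1) => x /IW; rewrite /= in_itv/= => /andP[_ /ltW].
  - by exists (a - 1) => x /IW; rewrite /= in_itv/= => /andP[/ltW].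
  - by exists (x, y).
have sumI n : (\sum_(0 <= k < n) nu (I k) <= e%:E)%E.
  apply: (@le_trans _ _ (\sum_(k < n) (G (uv k).2 - G (uv k).1))%:E).
    rewrite big_mkord -sumEFin; apply: lee_sum => k _.
    rewrite -(lebesgue_stieltjes_measure_oc _ (uvP k).1).
    apply: le_measure; rewrite ?inE//; first exact: mI.
    by rewrite (uvP k).2 => x /=; rewrite !in_itv/= => /andP[-> /ltW].
  rewrite lee_fin; apply: (le_trans (ler_sum _ (fun k _ => ler_norm _))).
  apply/ltW/Gd => [k|i j _ _|]; first exact: (uvP k).1.
    by rewrite -(uvP i).2 -(uvP j).2 => /tI ij; apply/val_inj/ij.
  rewrite -lte_fin; apply: le_lt_trans muW; rewrite -sumEFin.
  rewrite [leRHS](_ : _ = \sum_(0 <= k <oo) mu (I k))%E; last first.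
    by rewrite WI measure_semi_bigcup// -WI.
  apply: le_trans (nneseries_lim_ge n _) => //.
  rewrite big_mkord; apply: lee_sum => k _; rewrite (uvP k).2.
  rewrite lebesgue_measure_itv/= lte_fin -EFinD; case: ltP => // vu.
  by rewrite lee_fin subr_le0.
apply: (@le_trans _ _ (nu W)); first by apply: le_measure; rewrite ?inE.
rewrite WI measure_semi_bigcup//; last by rewrite -WI.
by apply: lime_le; [exact: is_cvg_nneseries|exact: nearW].
Qed.

(** The density is the Radon-Nikodym derivative of the Lebesgue-Stieltjes measure
    of g restricted to ]a, b], where it is finite. *)
Lemma nondecreasing_absolutely_continuous_density : exists h : R -> R,
  mu.-integrable setT (EFin \o h) /\
  forall x, a <= x <= b -> g x - g a = \int[mu]_(t in `]a, x]) h t.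
Proof.
have mD : measurable (`]a, b]%classic : set (measurableTypeR R)).
  exact: measurable_itv.
have nuD : (nu `]a, b]%classic < +oo)%E.
  by rewrite /nu/= lebesgue_stieltjes_measure_oc ?ltry// ltW.
pose nuab : {finite_measure set (measurableTypeR R) -> \bar R} := mfrestr mD nuD.
have nuab_mu : nuab `<< mu.
  apply/null_content_dominatesP => N mN N0; apply: nu_dominated.
  - exact: measurableI.
  - exact: subIsetr.
  - apply: (@subset_measure0 _ _ _ mu _ N) => //; exact: measurableI.
have [f [f0 ffin intf nuf]] := radon_nikodym_sigma_finite nuab_mu.
have fE : EFin \o (fine \o f) = f by apply/funext => t /=; rewrite fineK.
exists (fine \o f); split; first by rewrite fE.
move=> x /andP[ax xb].
have /(congr1 fine) := nuf `]a, x]%classic (measurable_itv _).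
rewrite /nuab/= /mfrestr /mrestr/= (_ : _ `&` _ = `]a, x]%classic); last first.
  apply/setIidPl => t /=; rewrite !in_itv/= => /andP[-> tx]; exact: le_trans xb.
have GE y : a <= y <= b -> G y = g y by move=> ?; rewrite /G compE clampE.
have -> : nu `]a, x]%classic = (g x - g a)%:E.
  rewrite /nu/= lebesgue_stieltjes_measure_oc//.
  by congr ((_ - _)%:E); apply: GE; rewrite ?ax ?lexx ?(ltW ab).
move=> /= ->; congr fine; apply: eq_integral => t _ /=.
by rewrite fineK.
Qed.

End monotone_density.

(** Lebesgue's theorem.  With V the total variation of f, the inequality
    |f y - f x| <= V y - V x makes V - f nondecreasing. *)
Lemma absolutely_continuous_density (R : realType) (a b : R) (f : R -> R) : a < b ->
  absolutely_continuous_on a b f -> exists h : R -> R,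
  (@lebesgue_measure R).-integrable setT (EFin \o h) /\
  forall x, a <= x <= b -> f x - f a = \int[lebesgue_measure]_(t in `]a, x]) h t.
Proof.
move=> ab fac; have leab := ltW ab.
have bvf := absolutely_continuous_bounded_variation leab fac.
have TVac := absolutely_continuous_total_variation leab fac.
set V := (fun x => fine _) in TVac.
have finV x : a <= x <= b -> total_variation a x f \is a fin_num.
  move=> /andP[ax xb]; apply: total_variation_fin_num => //.
  exact: (bounded_variationl ax xb).
have VB x y : a <= x <= b -> a <= y <= b -> x <= y -> `|f y - f x| <= V y - V x.
  move=> xab yab xy; have /andP[ax xb] := xab.
  rewrite -lee_fin EFinB /V !fineK ?finV// (total_variationD f ax xy).
  rewrite addeAC subee ?finV// add0e; exact: total_variation_ge.
have V_nd : {in `[a, b] &, nondecreasing_fun V}.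
  move=> x y xab yab xy; rewrite -subr_ge0; apply: le_trans (VB x y _ _ xy) => //.
have Vf_nd : {in `[a, b] &, nondecreasing_fun (V \- f)}.
  move=> x y xab yab xy; have := VB x y xab yab xy; rewrite /= => /ler_normlW; lra.
have [h1 [ih1 Vh1]] := nondecreasing_absolutely_continuous_density ab TVac V_nd.
have [h2 [ih2 Vh2]] := nondecreasing_absolutely_continuous_density ab
  (absolutely_continuousB TVac fac) Vf_nd.
exists (h1 \- h2); split.
  by have := integrableB measurableT ih1 ih2; apply: eq_integrable.
move=> x xab; rewrite RintegralB//; last 2 first.
- exact: integrableS ih1.
- exact: integrableS ih2.
by rewrite -(Vh1 _ xab) -(Vh2 _ xab)/=; ring.
Qed.

(** * From almost everywhere bounds on the derivative to bounds on the slopes *)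

Lemma ae_le_Rintegral d (T : measurableType d) (R : realType)
    (mu : {measure set T -> \bar R}) (D : set T) (f1 f2 : T -> R) :
  measurable D -> mu.-integrable D (EFin \o f1) -> mu.-integrable D (EFin \o f2) ->
  {ae mu, forall x, D x -> f1 x <= f2 x} ->
  \int[mu]_(x in D) f1 x <= \int[mu]_(x in D) f2 x.
Proof.
move=> mD if1 if2 f12; rewrite -subr_ge0 -RintegralB//.
have if21 : mu.-integrable D (EFin \o (f2 \- f1)).
  by apply: eq_integrable (integrableB mD if2 if1).
have mf21 := measurable_int _ if21.
have -> : \int[mu]_(x in D) (f2 x - f1 x) = \int[mu]_(x in D) `|f2 x - f1 x|.
  congr fine; apply: ae_eq_integral => //.
    by have := measurable_int _ (integrable_abse if21).
  by apply: filterS f12 => x h Dx; rewrite ger0_norm// subr_ge0 h.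
by apply: Rintegral_ge0.
Qed.

(** Stated without quotients, so that x = y is allowed. *)
Definition slopes_in (R : realType) (c C p q : R) (f : R -> R) :=
  forall x y, p <= x -> x <= y -> y <= q ->
  c * (y - x) <= f y - f x <= C * (y - x).

Lemma slopes_in_sub (R : realType) (c C p q p' q' : R) (f : R -> R) :
  p <= p' -> q' <= q -> slopes_in c C p q f -> slopes_in c C p' q' f.
Proof.
move=> pp' q'q cC x y p'x xy yq'.
by apply: cC => //; [exact: le_trans p'x|exact: le_trans q'q].
Qed.

Section slopes.
Context {R : realType}.
Notation mu := (@lebesgue_measure R).

Lemma derive1_addcst (F f : R -> R) (k t : R) : (\near t, F t + k = f t) ->
  derivable F t 1 -> derivable f t 1 /\ f^`()%classic t = F^`()%classic t.
Proof.
move=> Ff dF; have dFk : derivable (F + cst k) t 1 by apply: derivableD.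
split; first exact: near_eq_derivable dFk.
by rewrite !derive1E -(near_eq_derive _ Ff) deriveD// derive_cst addr0.
Qed.

(** Almost every t is a Lebesgue point of the density h, where f is therefore
    differentiable with derivative h t.  So h is almost everywhere between c and
    C, and f y - f x is its integral over ]x, y]. *)
Lemma absolutely_continuous_slopes (a b c C : R) (f : R -> R) :
  a < b -> absolutely_continuous_on a b f ->
  {ae mu, forall t : R, t \in `]a, b[ ->
     derivable f t 1 -> c <= f^`()%classic t <= C} ->
  slopes_in c C a b f.
Proof.
move=> ab fac cfC x y ax xy yb.
have [h [ih fh]] := absolutely_continuous_density ab fac.
have iS D : measurable D -> mu.-integrable D (EFin \o h).
  by move=> mD; apply: integrableS ih.
pose F x := \int[mu]_(t in [set` Interval (BRight a) (BRight x)]) h t.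
have hcC : {ae mu, forall t, `]x, y]%classic t -> c <= h t <= C}.
  have h1 : {ae mu, forall t : R, (BRight a < BRight t)%O ->
      derivable F t 1 /\ F^`()%classic t = h t}.
    apply: (@FTC1 _ h (BRight a)) => [z|]; first exact: iS.
    exact: open_integrable_locally openT ih.
  (* the bounds on f' concern the open interval ]a, b[, and y may be b *)
  have h2 : {ae mu, forall t, t != y}.
    exists [set y]; split => //=; first exact: lebesgue_measure_set1.
    by move=> t /= /negP; rewrite negbK => /eqP.
  have := ae_filter_ringOfSetsType mu => aeF.
  apply: filterS3 h1 h2 cfC => t h1 ty h3; rewrite /= in_itv/= => /andP[xt ty'].
  have tab : t \in `]a, b[.
    by rewrite in_itv/= (le_lt_trans ax xt)/= (lt_le_trans _ yb)// lt_neqAle ty.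
  have [] := h1; first by move: tab; rewrite in_itv/= bnd_simp => /andP[].
  move=> dF F't; have Ff : \near t, F t + f a = f t.
    near=> z; rewrite /F -fh ?subrK//.
    suff : z \in `]a, b[ by rewrite in_itv/= => /andP[/ltW -> /ltW ->].
    by near: z; exact: near_in_itvoo.
  have [df f't] := derive1_addcst Ff dF.
  by have := h3 tab df; rewrite f't F't.
have fyx : f y - f x = \int[mu]_(t in `]x, y]) h t.
  have -> : f y - f x = (f y - f a) - (f x - f a) by ring.
  rewrite !fh ?ax ?(le_trans ax xy) ?(le_trans xy) ?xy//.
  by rewrite Rintegral_itvB ?bnd_simp//; exact: iS.
have cst_int k : k * (y - x) = \int[mu]_(t in `]x, y]) k.
  rewrite Rintegral_cst//= lebesgue_measure_itv/= lte_fin.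
  case: ltP => //= yx; have -> : y = x by apply/le_anti/andP.
  by rewrite subrr.
have icst k : mu.-integrable `]x, y] (EFin \o cst k).
  apply: (@integrableS _ _ _ mu `[x, y]%classic) => //; first exact: subset_itv_oc_cc.
  apply: continuous_compact_integrable; first exact: segment_compact.
  by apply: continuous_subspaceT => ?; exact: cvg_cst.
have aeF := ae_filter_ringOfSetsType mu.
rewrite !cst_int fyx; apply/andP; split; apply: ae_le_Rintegral => //;
  try exact: iS; try exact: icst.
- by apply: filterS hcC => t h0 /h0/andP[].
- by apply: filterS hcC => t h0 /h0/andP[].
Unshelve. all: by end_near. Qed.

End slopes.

(** * Quadrature estimates from slopes *)

Section quadrature.
Context {R : realType}.
Notation mu := (@lebesgue_measure R).
Implicit Types (f : R -> R) (p q c C : R).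

Lemma integrable_affine (x y p q : R) :
  mu.-integrable `[p, q] (EFin \o (fun t => x + y * t)).
Proof.
apply: continuous_compact_integrable; first exact: segment_compact.
apply: continuous_subspaceT => t; apply: cvgD; first exact: cvg_cst.
by apply: cvgM; [exact: cvg_cst|exact: cvg_id].
Qed.

Lemma Rintegral_affine (x y p q : R) : p <= q ->
  \int[mu]_(t in `[p, q]) (x + y * t) = x * (q - p) + y * (q ^+ 2 - p ^+ 2) / 2.
Proof.
rewrite le_eqVlt => /predU1P[<-|pq].
  by rewrite set_itv1 Rintegral_set1; ring.
pose F : R -> R := fun t => x * t + y / 2 * t ^+ 2.
have dF (t : R) : is_derive t 1 F (x + y * t).
  by apply: is_derive_eq; rewrite /GRing.scale/=; field.
rewrite /Rintegral (@continuous_FTC2 _ _ F)//=.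
- by rewrite /F; field.
- apply: continuous_subspaceT => t; apply: cvgD; first exact: cvg_cst.
  by apply: cvgM; [exact: cvg_cst|exact: cvg_id].
- have cF (t : R) : {for t, continuous F}.
    by apply: differentiable_continuous; apply/derivable1_diffP; case: (dF t).
  split=> [t _||]; first by case: (dF t).
  + exact/cvg_at_right_filter/cF.
  + exact/cvg_at_left_filter/cF.
- by move=> t _; rewrite derive1E; have [_ ->] := dF t.
Qed.

(** The four bounds come from the affine functions through (p, f p) or (q, f q)
    with slope c or C. *)
Lemma Rintegral_slopes c C p q f : p <= q -> mu.-integrable `[p, q] (EFin \o f) ->
  slopes_in c C p q f ->
  let I := \int[mu]_(t in `[p, q]) f t in
  (q - p) * f p + c * (q - p) ^+ 2 / 2 <= I <= (q - p) * f p + C * (q - p) ^+ 2 / 2 /\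
  (q - p) * f q - C * (q - p) ^+ 2 / 2 <= I <= (q - p) * f q - c * (q - p) ^+ 2 / 2.
Proof.
move=> pq intf cC I.
have le_affine x y : (forall t, p <= t <= q -> f t <= x + y * t) ->
    I <= x * (q - p) + y * (q ^+ 2 - p ^+ 2) / 2.
  move=> fxy; rewrite -Rintegral_affine//; apply: le_Rintegral => //.
  exact: integrable_affine.
have ge_affine x y : (forall t, p <= t <= q -> x + y * t <= f t) ->
    x * (q - p) + y * (q ^+ 2 - p ^+ 2) / 2 <= I.
  move=> fxy; rewrite -Rintegral_affine//; apply: le_Rintegral => //.
  exact: integrable_affine.
split; apply/andP; split.
- apply: le_trans (ge_affine (f p - c * p) c _); first by nra.
  move=> t /andP[pt tq]; have := cC p t (lexx p) pt tq; lra.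
- apply: le_trans (le_affine (f p - C * p) C _) _; last by nra.
  move=> t /andP[pt tq]; have := cC p t (lexx p) pt tq; lra.
- apply: le_trans (ge_affine (f q - C * q) C _); first by nra.
  move=> t /andP[pt tq]; have := cC t q pt tq (lexx q); lra.
- apply: le_trans (le_affine (f q - c * q) c _) _; last by nra.
  move=> t /andP[pt tq]; have := cC t q pt tq (lexx q); lra.
Qed.

Lemma Rintegral_itvcc_split p q r f : p <= q -> q <= r ->
  mu.-integrable `[p, r] (EFin \o f) ->
  \int[mu]_(t in `[p, r]) f t =
  \int[mu]_(t in `[p, q]) f t + \int[mu]_(t in `[q, r]) f t.
Proof.
move=> pq qr intf; rewrite -(@Rintegral_itv_obnd_cbnd _ q).
  by rewrite -(Rintegral_itvB intf) ?bnd_simp// addrC subrK.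
apply: integrableS intf => // t /=; rewrite !in_itv/= => /andP[qt ->].
by rewrite (le_trans pq)// ltW.
Qed.

Lemma integrable_subcc p q p' q' f : p <= p' -> q' <= q ->
  mu.-integrable `[p, q] (EFin \o f) -> mu.-integrable `[p', q'] (EFin \o f).
Proof.
move=> pp' q'q; apply: integrableS => // t /=; rewrite !in_itv/= => /andP[p't tq'].
by rewrite (le_trans pp')//= (le_trans tq').
Qed.

Section symmetric_rule.
Variables (c C w : R) (f : R -> R).
Hypotheses (intf : mu.-integrable `[0, 1] (EFin \o f)) (cC : slopes_in c C 0 1 f).

Let Q := \int[mu]_(t in `[0, 1]) f t - (w * f 0 + (1 - 2 * w) * f (1 / 2) + w * f 1).

(** The pieces [0, w], [w, 1 - w] and [1 - w, 1] have the weights of the nodes as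
    lengths; f is compared with the endpoint value on the outer pieces, and with
    the middle value on both halves of the inner one. *)
Lemma symmetric_rule_range : 0 <= w <= 1 / 2 ->
  `|Q| <= (C - c) / 2 * (w ^+ 2 + (1 / 2 - w) ^+ 2).
Proof.
move=> /andP[w0 w2].
have piece p q (p0 : 0 <= p) (pq : p <= q) (q1 : q <= 1) :=
  Rintegral_slopes pq (integrable_subcc p0 q1 intf) (slopes_in_sub p0 q1 cC).
have h01 : 0 <= 1 / 2 :> R by lra.
have h12 : 1 / 2 <= 1 :> R by lra.
have h1w : 1 / 2 <= 1 - w by lra.
have hw1 : 1 - w <= 1 by lra.
have w1 := le_trans w2 h12.
have h0w : 0 <= 1 - w by lra.
rewrite /Q (Rintegral_itvcc_split h01 h12 intf).
rewrite (Rintegral_itvcc_split w0 w2 (integrable_subcc (lexx 0) h12 intf)).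
rewrite (Rintegral_itvcc_split h1w hw1 (integrable_subcc h01 (lexx 1) intf)).
have [/andP[l1 u1] _] := piece _ _ (lexx 0) w0 w1.
have [_ /andP[l2 u2]] := piece _ _ w0 w2 h12.
have [/andP[l3 u3] _] := piece _ _ h01 h1w hw1.
have [_ /andP[l4 u4]] := piece _ _ h0w hw1 (lexx 1).
rewrite ler_norml; apply/andP; split; nra.
Qed.

(** Slope bounds on the two halves of [0, 1] reduce the claim to
    (1 / 2 - 2 * w) * (f (1 / 2) - f 0 - c / 2) >= 0 and its analogues, which is
    why w <= 1 / 4 is required. *)
Lemma symmetric_rule_increment : 0 <= w <= 1 / 4 ->
  `|Q| <= (1 / 2 - w) * (f 1 - f 0 - c) /\ `|Q| <= (1 / 2 - w) * (C - (f 1 - f 0)).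
Proof.
move=> /andP[w0 w4].
have h01 : 0 <= 1 / 2 :> R by lra.
have h12 : 1 / 2 <= 1 :> R by lra.
have intl := integrable_subcc (lexx 0) h12 intf.
have intr := integrable_subcc h01 (lexx 1) intf.
rewrite /Q (Rintegral_itvcc_split h01 h12 intf).
have [/andP[l1 u1] /andP[l2 u2]] :=
  Rintegral_slopes h01 intl (slopes_in_sub (lexx 0) h12 cC).
have [/andP[l3 u3] /andP[l4 u4]] :=
  Rintegral_slopes h12 intr (slopes_in_sub h01 (lexx 1) cC).
have /andP[s1 s2] := cC (lexx 0) h01 h12.
have /andP[s3 s4] := cC h01 h12 (lexx 1).
by split; rewrite ler_norml; apply/andP; split; nra.
Qed.

End symmetric_rule.
End quadrature.

(* An absolutely continuous f is differentiable at almost every t; f^`() is the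
   derivative there, and 0 at the remaining (negligible) points. The values of
   f outside [0, 1] do not affect f^`() on the open interval ]0, 1[. *)
Theorem theorem5 (R : realType) (f : R -> R) (gamma1 Gamma1 : R)
  (f_ac : absolutely_continuous_on 0 1 f)
  (df_L1 : (@lebesgue_measure R).-integrable `]0, 1[ (EFin \o f^`()%classic))
  (df_bounds : {ae @lebesgue_measure R, forall t : R, t \in `]0, 1[%R ->
     derivable f t 1 -> gamma1 <= f^`()%classic t <= Gamma1}) :
  let S := f 1 - f 0 in
  [/\ `|Q01 f| <= (Gamma1 - gamma1) / 32 * (5 - 2 * Num.sqrt 2),
      `|Q01 f| <= (1 / 2 - Num.sqrt 2 / 8) * (S - gamma1) &
      `|Q01 f| <= (1 / 2 - Num.sqrt 2 / 8) * (Gamma1 - S)].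
Proof.
have f_slopes := absolutely_continuous_slopes ltr01 f_ac df_bounds.
have f_int := absolutely_continuous_integrable ltr01 f_ac.
have s0 : 0 <= Num.sqrt 2 :> R by exact: sqrtr_ge0.
have s2 : Num.sqrt 2 ^+ 2 = 2 :> R by rewrite sqr_sqrtr.
have w_ge0 : 0 <= Num.sqrt 2 / 8 :> R by lra.
have w_le4 : Num.sqrt 2 / 8 <= 1 / 4 :> R by nra.
have w_le2 : Num.sqrt 2 / 8 <= 1 / 2 :> R by lra.
have QE : Q01 f = \int[lebesgue_measure]_(t in `[0, 1]) f t -
    (Num.sqrt 2 / 8 * f 0 + (1 - 2 * (Num.sqrt 2 / 8)) * f (1 / 2)
     + Num.sqrt 2 / 8 * f 1).
  by rewrite /Q01; congr (_ - (_ + _ * _ + _)); field.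
have [|Qc QC] := @symmetric_rule_increment R gamma1 Gamma1 (Num.sqrt 2 / 8) f
  f_int f_slopes; first exact/andP.
rewrite QE; split => //.
have h := @symmetric_rule_range R gamma1 Gamma1 (Num.sqrt 2 / 8) f f_int f_slopes.
apply: (le_trans (h _)); first exact/andP.
rewrite (_ : (Num.sqrt 2 / 8) ^+ 2 + (1 / 2 - Num.sqrt 2 / 8) ^+ 2 =
  (5 - 2 * Num.sqrt 2) / 16 :> R); last by lra.
by rewrite le_eqVlt; apply/orP; left; apply/eqP; field.
Qed.
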